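(* Let $\mathfrak g$ be a classical simple Lie algebra of type $A$, $B$, $C$, or $D$ over $\mathbb C$, with Weyl group $W$ and highest root $\tilde\alpha$. Then the Weyl alternation set associated to the pair of dominant weights $\lambda=\tilde\alpha$ and $\mu=\tilde\alpha$ is \[\mathcal A(\tilde\alpha,\tilde\alpha)=\{1\}.\]
   Context: For dominant integral weights $\lambda,\mu$ of $\mathfrak g$, the Weyl alternation set is $\mathcal A(\lambda,\mu)=\{\sigma\in W:\wp(\sigma(\lambda+\rho)-(\mu+\rho))>0\}$, where $\rho$ is half the sum of the positive roots (with respect to a fixed choice of positive roots) and $\wp(\xi)$ is Kostant's partition function, the number of ways $\xi$ may be written as a nonnegative integral sum of positive roots. *)

(* Defs.v *)
From HB Require Import structures.
From mathcomp Require Import all_boot all_order all_algebra.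
From mathcomp Require Import finmap.
From mathcomp Require Import mathcomp_extra boolp classical_sets cardinality fsbigop reals.
From mathcomp Require Import complex.
Set Implicit Arguments.
Unset Strict Implicit.
Unset Printing Implicit Defensive.
Import GRing.Theory.
Local Open Scope classical_set_scope.
Local Open Scope ring_scope.

Record lieAlgebra (K : fieldType) := LieAlgebra {
  lie_carrier :> vectType K;
  lie_bracket : lie_carrier -> lie_carrier -> lie_carrier;
  lie_linearl : forall z, linear (lie_bracket^~ z);
  lie_linearr : forall x, linear (lie_bracket x);
  lie_alt : forall x, lie_bracket x x = 0;
  lie_jacobi : forall x y z,
    lie_bracket x (lie_bracket y z) + lie_bracket y (lie_bracket z x)
      + lie_bracket z (lie_bracket x y) = 0
}.

Notation "[[ x , y ]]" := (lie_bracket x y)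
  (at level 0, x, y at level 99, format "[[ x ,  y ]]") : ring_scope.

(* The dual space of the Cartan subalgebra [h]. *)
Notation weight h := 'Hom(subvs_of h, GRing.regular _).

Section RootSystem.
Variables (K : fieldType) (g : lieAlgebra K) (h : {vspace g}).
Implicit Types (alpha beta theta lambda mu xi : weight h) (Delta : seq (weight h)).

Definition root_space alpha : set g :=
  [set x | forall H : subvs_of h, [[vsval H, x]] = alpha H *: x].

Definition is_root : set (weight h) :=
  [set alpha | alpha != 0 /\ exists2 x, x != 0 & root_space alpha x].

(* For a root of a semisimple Lie algebra, [g_alpha, g_-alpha] is a line in [h]
   on which [alpha] does not vanish, so there is exactly one such [H]. *)
Definition is_coroot alpha (H : subvs_of h) : Prop :=
  (exists x y, [/\ root_space alpha x, root_space (- alpha) y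
                 & [[x, y]] = vsval H])
  /\ alpha H = 2%:R.

Definition reflection alpha (H : subvs_of h) : 'End(weight h) :=
  linfun (fun lambda : weight h => lambda - (lambda H *: alpha : weight h)).

(* Reflections are involutions, so closure under products suffices. *)
Inductive weyl_group : 'End(weight h) -> Prop :=
| weyl_one : weyl_group \1%VF
| weyl_mul alpha H sigma :
    is_root alpha -> is_coroot alpha H -> weyl_group sigma ->
    weyl_group (reflection alpha H \o sigma)%VF.

Definition nat_span Delta : set (weight h) :=
  [set lambda | exists c : 'I_(size Delta) -> nat,
    lambda = \sum_(i < size Delta) Delta`_i *+ c i].

(* A choice of positive roots is given by its set of simple roots. *)
Definition simple_system Delta : Prop :=
  [/\ free Delta,
      (forall alpha, alpha \in Delta -> is_root alpha)
    & (forall alpha, is_root alpha ->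
         nat_span Delta alpha \/ nat_span Delta (- alpha))].

Definition positive_roots Delta : set (weight h) :=
  is_root `&` nat_span Delta.

Definition highest_root Delta theta : Prop :=
  is_root theta /\ forall beta, is_root beta -> nat_span Delta (theta - beta).

Definition rho Delta : weight h :=
  2%:R^-1 *: \sum_(alpha \in positive_roots Delta) alpha.

Definition partitions Delta xi : set (weight h -> nat) :=
  [set m | (forall alpha, ~ positive_roots Delta alpha -> m alpha = 0%N)
         /\ xi = \sum_(alpha \in positive_roots Delta) alpha *+ m alpha].

(* [fset_set] returns the empty set on infinite sets; [partitions Delta xi] is
   finite when [Delta] is a simple system and there are finitely many roots,
   in characteristic 0. *)
Definition kostant Delta xi : nat := #|` fset_set (partitions Delta xi)|%fset.

Definition weyl_alternation_set Delta lambda mu : set 'End(weight h) :=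
  [set sigma | weyl_group sigma /\
    (0 < kostant Delta (sigma (lambda + rho Delta) - (mu + rho Delta))%R)%N].

End RootSystem.

Inductive classical_type := TypeA | TypeB | TypeC | TypeD.

(* The ranks for which sl_(r+1), so_(2r+1), sp_(2r), so_(2r) are simple;
   so_2 is abelian and so_4 = sl_2 x sl_2. *)
Definition simple_rank (X : classical_type) (r : nat) : bool :=
  (if X is TypeD then 3 <= r else 1 <= r)%N.

Definition natural_dim (X : classical_type) (r : nat) : nat :=
  match X with
  | TypeA => r.+1
  | TypeB => r.*2.+1
  | TypeC | TypeD => r.*2
  end.

(* Antidiagonal forms, for which the diagonal matrices of so_n and sp_n form a
   Cartan subalgebra. *)
Definition orthogonal_form (K : fieldType) (n : nat) : 'M[K]_n :=
  \matrix_(i, j) (i + j == n.-1)%N%:R.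

Definition symplectic_form (K : fieldType) (n : nat) : 'M[K]_n :=
  \matrix_(i, j) ((-1) ^+ (n./2 <= i)%N * (i + j == n.-1)%N%:R).

Definition preserves_form (K : fieldType) (n : nat) (J M : 'M[K]_n) : Prop :=
  M^T *m J + J *m M = 0.

Definition classical_matrix (K : fieldType) (X : classical_type) (r : nat)
    (M : 'M[K]_(natural_dim X r)) : Prop :=
  match X with
  | TypeA => \tr M = 0
  | TypeB | TypeD => preserves_form (orthogonal_form K _) M
  | TypeC => preserves_form (symplectic_form K _) M
  end.

(* [g] is isomorphic to the matrix Lie algebra of type X_r, by an isomorphism
   carrying [h] to the diagonal matrices.  All Cartan subalgebras being
   conjugate, over an algebraically closed field of characteristic 0 (and for
   simple_rank X r) this holds for every Cartan subalgebra [h] of a Lie algebra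
   [g] of type X_r. *)
Definition classical_with_cartan (K : fieldType) (X : classical_type) (r : nat)
    (g : lieAlgebra K) (h : {vspace g}) : Prop :=
  exists f : 'Hom(g, 'M[K]_(natural_dim X r)),
    [/\ injective f,
        (forall M, classical_matrix M <-> exists x, f x = M),
        (forall x y, f [[x, y]] = f x *m f y - f y *m f x)
      & (forall x, (x \in h) = is_diag_mx (f x))].

(* Main.v *)
Require Import Defs.
From HB Require Import structures.
From mathcomp Require Import all_boot all_order all_algebra.
From mathcomp Require Import zify.
From mathcomp Require Import fingroup perm finmap.
From mathcomp Require Import boolp classical_sets cardinality fsbigop reals complex.
Set Implicit Arguments.
Unset Strict Implicit.
Unset Printing Implicit Defensive.
Import Order.TTheory GRing.Theory Num.Theory.
Local Open Scope classical_set_scope.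
Local Open Scope ring_scope.
Local Open Scope complex_scope.

(** Write Q+ for the natural-number span of the simple roots; it is pointed, that
    is, two of its elements with sum 0 both vanish ([nat_span_pointed]).

    Let sigma be a Weyl group element in the alternation set, so that
    xi = sigma (theta + rho) - (theta + rho) lies in Q+.  As sigma permutes the
    roots, theta - sigma theta lies in Q+ because theta is highest.  Reindexing
    the sum 2 rho along sigma writes 2 rho - sigma (2 rho) as a sum, over all
    roots alpha, of sigma alpha if sigma alpha is positive, minus sigma alpha
    if alpha is positive; each of these terms is again in Q+.  The three
    contributions add up to zero after doubling, so every term is zero, which
    says that sigma sends positive roots to positive roots
    ([alternating_preserves_positive]).

    That only the identity preserves positivity is seen in coordinates.  Let
    eps_i be the i-th diagonal entry as a weight.  All roots are differences
    eps_i - eps_j, and the Weyl group permutes the eps_i: the coroots are found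
    from the trace form ([coroot_trace_dual]).  If sigma acts by the permutation
    pi and preserves positivity then

    - eps_k - eps_(pi k) is never a root: being of finite order, sigma cannot
      move a weight by an element of Q+ or of - Q+ ([displacement_not_root]);
    - no root is sent to its opposite ([root_not_negated]).

    For sl_n and sp_n every difference of two distinct indices is a root, so the
    first point gives pi = 1.  For so_n the only non-roots are the
    eps_k - eps_k', where k' is the mirror image of k, so a moved index goes to
    its mirror image; by the second point at most one pair {k, k'} is exchanged.
    If n is odd, the middle index, whose weight is zero, makes eps_k a root, and
    this root would be negated.  If n is even, pi would be a transposition,
    whereas every reflection of so_n acts by an even permutation. *)

(** * Reflections *)

Section Reflection.
Variables (K : numFieldType) (g : lieAlgebra K) (h : {vspace g}).

Lemma reflectionE (alpha : weight h) H (lambda : weight h) :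
  reflection alpha H lambda = lambda - (lambda H *: alpha : weight h).
Proof.
pose F (u : weight h) : weight h := u - (u H *: alpha : weight h).
have linF : linear F.
  move=> c u v; rewrite /F add_lfunE scale_lfunE scalerDl -scalerA scalerBr.
  by rewrite opprD addrACA.
pose L : {linear weight h -> weight h} :=
  HB.pack F (GRing.isLinear.Build _ _ _ _ F linF).
exact: (lfunE L).
Qed.

Lemma weyl_group_inj (sigma : 'End(weight h)) :
  weyl_group sigma -> injective sigma.
Proof.
elim=> [u v|alpha H tau _ [_ aH] _ IH u v]; first by rewrite !lfunE.
rewrite !comp_lfunE; set s := reflection alpha H.
suff sK : involutive s by move=> /(inv_inj sK) /IH.
move=> w; rewrite /s !reflectionE add_lfunE opp_lfunE scale_lfunE aH.
rewrite -addrA -opprD -scalerDl addrC.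
by rewrite -[w H *: _]/(w H * 2) addrA -mulr2n mulr_natr subrr scale0r oppr0 add0r.
Qed.
End Reflection.

(** * The cone spanned by the simple roots *)

Section Cone.
Variables (K : numFieldType) (g : lieAlgebra K) (h : {vspace g}).
Variable Delta : seq (weight h).
Implicit Types (u v : weight h).

Lemma nat_span0 : nat_span Delta 0.
Proof. by exists (fun=> 0%N); rewrite big1. Qed.

Lemma nat_spanD u v : nat_span Delta u -> nat_span Delta v ->
  nat_span Delta (u + v).
Proof.
move=> [a ->] [b ->]; exists (fun i => (a i + b i)%N).
by rewrite -big_split; apply: eq_bigr => i _; rewrite mulrnDr.
Qed.

Lemma nat_spanMn u m : nat_span Delta u -> nat_span Delta (u *+ m).
Proof.
move=> Su; elim: m => [|m IH]; first by rewrite mulr0n; apply: nat_span0.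
by rewrite mulrS; apply: nat_spanD.
Qed.

Lemma nat_span_sum (I : Type) (s : seq I) (P : pred I) (F : I -> weight h) :
  (forall i, P i -> nat_span Delta (F i)) ->
  nat_span Delta (\sum_(i <- s | P i) F i).
Proof.
by move=> SF; apply: big_ind => //; [exact: nat_span0 | exact: nat_spanD].
Qed.

Lemma nat_span_simple u : u \in Delta -> nat_span Delta u.
Proof.
move=> /(nthP 0)[i ltiD <-]; exists (fun j => (j == Ordinal ltiD) : nat).
rewrite (bigD1 (Ordinal ltiD)) //= eqxx mulr1n big1 ?addr0 // => j /negPf->.
by rewrite mulr0n.
Qed.

Hypothesis freeD : free Delta.

(** Natural numbers with sum 0 are 0, also after mapping them to a field of
    characteristic 0, and the simple roots are linearly independent. *)
Lemma nat_span_pointed u v : nat_span Delta u -> nat_span Delta v ->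
  u + v = 0 -> u = 0.
Proof.
move=> [a ->] [b ->]; rewrite -big_split /= => uv0.
apply: big1 => i _.
have /freeP/(_ (fun j => (a j + b j)%:R)) cD : free (in_tuple Delta) by [].
have /cD/(_ i)/eqP : \sum_(j < size Delta) (a j + b j)%:R *: Delta`_j = 0.
  by rewrite -[RHS]uv0; apply: eq_bigr => j _; rewrite scaler_nat mulrnDr.
by rewrite pnatr_eq0 addn_eq0 => /andP[/eqP-> _]; rewrite mulr0n.
Qed.

Lemma nat_span_sum_eq0 (I : eqType) (s : seq I) (F : I -> weight h) :
  {in s, forall i, nat_span Delta (F i)} -> \sum_(i <- s) F i = 0 ->
  {in s, forall i, F i = 0}.
Proof.
move=> SF + i si; rewrite (big_rem i) //= big_seq.
apply: nat_span_pointed (SF i si) (nat_span_sum _ _) => j /mem_rem; exact: SF.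
Qed.

(** If sigma moves u by an element of the cone, then so do its powers, and the
    displacements of successive powers telescope: when a power fixes u they add
    up to zero, so each of them is zero. *)
Lemma nat_span_iter_fixed (sigma : 'End(weight h)) u N :
  (forall v, nat_span Delta v -> nat_span Delta (sigma v)) ->
  iter N.+1 sigma u = u -> nat_span Delta (u - sigma u) -> sigma u = u.
Proof.
move=> stab; rewrite iterSr => uN Su.
have SuN m : nat_span Delta (sigma u - iter m sigma (sigma u)).
  elim: m => [|m IH]; first by rewrite subrr; apply: nat_span0.
  rewrite -(subrKA (iter m sigma (sigma u))); apply: nat_spanD => //.
  rewrite -!iterSr; elim: m.+1 => [|k IHk] //.
  by rewrite (iterS k) (iterS k.+1) -raddfB; apply: stab.
by apply/esym/eqP; rewrite -subr_eq0; apply/eqP;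
  apply: nat_span_pointed Su (SuN N) _; rewrite uN subrKA subrr.
Qed.
End Cone.

(** * Kostant's partition function *)

Section Positive.
Variables (K : numFieldType) (g : lieAlgebra K) (h : {vspace g}).
Variable Delta : seq (weight h).
Hypothesis sD : simple_system Delta.
Hypothesis finR : finite_set (@is_root K g h).
Implicit Types (alpha beta : weight h).

Let freeD : free Delta. Proof. by case: sD. Qed.

Lemma finite_positive : finite_set (positive_roots Delta).
Proof. exact: finite_setIl. Qed.

Lemma partitions_of_0 : partitions Delta 0 = [set fun=> 0%N].
Proof.
apply/seteqP; split=> [m [m0] | _ ->]; last first.
  by split=> //; rewrite fsbig1 // => a _; rewrite mulr0n.
rewrite (fsbig_finite _ _ finite_positive) => /esym Sm.
apply/funext => a; have [Pa|/m0//] := pselect (positive_roots Delta a).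
have SP b : nat_span Delta (b *+ m b).
  have [ [_ ?]|/m0->] := pselect (positive_roots Delta b).
    exact: nat_spanMn.
  by rewrite mulr0n; apply: nat_span0.
have /(_ a) := nat_span_sum_eq0 freeD (in1W SP) Sm.
rewrite in_fset_set; last exact: finite_positive.
rewrite inE => /(_ Pa); case: Pa => -[a0 _] _.
move/eqP; rewrite -scaler_nat scaler_eq0 (negPf a0) orbF pnatr_eq0.
by move/eqP.
Qed.

Lemma kostant0 : kostant Delta 0 = 1%N.
Proof. by rewrite /kostant partitions_of_0 fset_set1 cardfs1. Qed.

Lemma kostant_gt0 xi : (0 < kostant Delta xi)%N -> nat_span Delta xi.
Proof.
move=> k0; have [m [m0 ->] ] : partitions Delta xi !=set0.
  apply/set0P; apply: contraTneq k0; rewrite /kostant => ->.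
  by rewrite fset_set0 cardfs0.
rewrite (fsbig_finite _ _ finite_positive); apply: nat_span_sum => a _.
have [ [_ ?]|/m0->] := pselect (positive_roots Delta a).
  exact: nat_spanMn.
by rewrite mulr0n; apply: nat_span0.
Qed.
End Positive.

(** * Elements of the alternation set preserve positivity *)

Section AlternatingElement.
Variables (K : numFieldType) (g : lieAlgebra K) (h : {vspace g}).
Variables (Delta : seq (weight h)) (theta : weight h) (sigma : 'End(weight h)).
Hypothesis sD : simple_system Delta.
Hypothesis finR : finite_set (@is_root K g h).
Hypothesis rootN : forall alpha : weight h, is_root alpha -> is_root (- alpha).
Hypothesis sigma_inj : injective sigma.
Hypothesis sigma_root : forall alpha, is_root alpha -> is_root (sigma alpha).

Let freeD : free Delta. Proof. by case: sD. Qed.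

Let pos (a : weight h) : bool := `[< positive_roots Delta a >].

Lemma positive_dichotomy (alpha : weight h) :
  is_root alpha -> pos alpha \/ pos (- alpha).
Proof.
move=> Ra; have [_ _ /(_ _ Ra)] := sD.
by case=> Sa; [left | right]; apply/asboolP; split=> //; apply: rootN.
Qed.

Lemma sum_positive_roots :
  \sum_(a \in positive_roots Delta) a
    = \sum_(a <- fset_set (@is_root K g h)) (if pos a then a else 0).
Proof.
rewrite (fsbig_finite _ _ (finite_positive Delta finR)).
rewrite -big_mkcond -[RHS]big_filter; apply: perm_big.
apply: uniq_perm => [||a]; [exact: fset_uniq | by rewrite filter_uniq |].
rewrite mem_filter !in_fset_set //; last exact: finite_positive.
by apply/idP/andP; rewrite !inE; [move=> Pa; split=> //; case: Pa | case].
Qed.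

Lemma perm_roots :
  perm_eq [seq sigma a | a <- fset_set (@is_root K g h)]
          (fset_set (@is_root K g h)).
Proof.
have U : uniq [seq sigma a | a <- fset_set (@is_root K g h)].
  by rewrite map_inj_uniq ?fset_uniq.
have /(uniq_min_size U) : {subset [seq sigma a | a <- fset_set (@is_root K g h)]
    <= fset_set (@is_root K g h)}.
  move=> a /mapP[b]; rewrite !in_fset_set // !inE => Rb ->.
  exact: sigma_root.
rewrite size_map leqnn => /(_ isT)[_ eqR].
by apply: uniq_perm => //; exact: fset_uniq.
Qed.

(** Twice theta - sigma theta, 2 rho - sigma (2 rho) and twice the weight being
    partitioned are in the cone and add up to zero. *)
Lemma alternating_preserves_positive :
  highest_root Delta theta ->
  nat_span Delta (sigma (theta + rho Delta) - (theta + rho Delta)) ->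
  forall alpha, positive_roots Delta alpha ->
    positive_roots Delta (sigma alpha).
Proof.
move=> [Rt maxt] Sxi alpha Pa.
(* The summands of 2 rho - sigma (2 rho), once 2 rho is reindexed along sigma
   in its first occurrence only. *)
pose F a := (if pos (sigma a) then sigma a else 0)
  - (if pos a then sigma a else 0).
have SF a : is_root a -> nat_span Delta (F a).
  move=> Ra; rewrite /F; case: ifPn => [/asboolP[_ Ssa]|Nsa]; case: ifPn => _.
  - by rewrite subrr; apply: nat_span0.
  - by rewrite subr0.
  - by case: (positive_dichotomy (sigma_root Ra)) Nsa => [->//|/asboolP[] ];
      rewrite sub0r.
  - by rewrite subr0; apply: nat_span0.
set Rs := fset_set (@is_root K g h).
have rhoE : rho Delta *+ 2 - sigma (rho Delta *+ 2) = \sum_(a <- Rs) F a.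
  have -> : rho Delta *+ 2 = \sum_(a \in positive_roots Delta) a.
    by rewrite /rho -scaler_nat scalerA divff ?scale1r // pnatr_eq0.
  rewrite sumrB; congr (_ - _).
    by rewrite sum_positive_roots -(perm_big _ perm_roots) big_map.
  rewrite sum_positive_roots raddf_sum; apply: eq_bigr => a _.
  by case: ifP; rewrite ?raddf0.
have SFR a : a \in Rs -> nat_span Delta (F a).
  by rewrite in_fset_set // inE; apply: SF.
have SS : nat_span Delta (\sum_(a <- Rs) F a).
  by rewrite big_seq; apply: nat_span_sum.
have S0 : \sum_(a <- Rs) F a = 0.
  apply: (nat_span_pointed freeD SS).
    apply: nat_spanD (nat_spanMn 2 (maxt _ (sigma_root Rt))) (nat_spanMn 2 Sxi).
  rewrite -rhoE linearMn -mulrnBl -!mulrnDl addrA [_ + (theta - _)]addrACA -opprD.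
  by rewrite -linearD [rho Delta + _]addrC subrKA subrr mul0rn.
have Ra : is_root alpha by case: Pa.
have aR : alpha \in Rs by rewrite in_fset_set ?inE.
have := nat_span_sum_eq0 freeD SFR S0 aR.
rewrite /F (_ : pos alpha); last exact/asboolP.
case: ifPn => [/asboolP//|_ /eqP]; rewrite sub0r oppr_eq0 -(raddf0 sigma) => /eqP.
by move/sigma_inj; case: Ra => /eqP.
Qed.
End AlternatingElement.

(** * Linear maps preserving positivity *)

Section PositiveStable.
Variables (K : numFieldType) (g : lieAlgebra K) (h : {vspace g}).
Variables (Delta : seq (weight h)) (sigma : 'End(weight h)).
Hypothesis sD : simple_system Delta.
Hypothesis sigma_pos : forall alpha, positive_roots Delta alpha ->
  positive_roots Delta (sigma alpha).

Let freeD : free Delta. Proof. by case: sD. Qed.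

Lemma nat_span_stable v : nat_span Delta v -> nat_span Delta (sigma v).
Proof.
move=> [c ->]; rewrite linear_sum; apply: nat_span_sum => i _ /=.
rewrite linearMn; apply: nat_spanMn.
have Di : Delta`_i \in Delta by rewrite mem_nth.
have [_ RD _] := sD.
by have [] : positive_roots Delta (sigma Delta`_i)
  by apply: sigma_pos; split; [exact: RD | exact: nat_span_simple].
Qed.

(** A root or its opposite is in the cone, so [nat_span_iter_fixed] applies to v
    or to - v. *)
Lemma displacement_not_root v N :
  iter N.+1 sigma v = v -> ~ is_root (v - sigma v).
Proof.
move=> vN Rv; have [_ _ /(_ _ Rv) SvN] := sD; case: Rv => /eqP[].
have iterV w m : iter m sigma (- w) = - iter m sigma w.
  by elim: m => //= m ->; rewrite linearN.
case: SvN => Sv.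
  by rewrite (nat_span_iter_fixed freeD nat_span_stable vN Sv) subrr.
have := nat_span_iter_fixed freeD (sigma := sigma) (u := - v) (N := N) nat_span_stable.
rewrite iterV vN linearN opprK addrC -opprB => /(_ erefl Sv)/oppr_inj->.
by rewrite subrr.
Qed.

Lemma perm_displacement_not_root n (e : 'I_n -> weight h) (pi : 'S_n) k :
  (forall l, sigma (e l) = e (pi l)) -> ~ is_root (e k - e (pi k)).
Proof.
move=> sE; rewrite -sE; apply: (displacement_not_root (N := #[pi].-1%g)).
have pik m : iter m sigma (e k) = e (iter m pi k) by elim: m => //= m ->.
by rewrite prednK ?order_gt0 // pik -permX expg_order perm1.
Qed.

Hypothesis rootN : forall alpha : weight h, is_root alpha -> is_root (- alpha).

Lemma root_not_negated alpha : is_root alpha -> sigma alpha <> - alpha.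
Proof.
have negP beta : positive_roots Delta beta -> sigma beta <> - beta.
  move=> Pb sb; have := sigma_pos Pb; rewrite sb => -[_ SNb].
  case: Pb => -[b0 _] Sb; case/eqP: b0.
  by apply: (nat_span_pointed freeD Sb SNb); rewrite subrr.
move=> Ra sa; have [_ _ /(_ _ Ra)] := sD; case=> Sa.
  exact: (negP alpha).
by apply: (negP (- alpha)); [split=> //; apply: rootN | rewrite (linearN sigma) /= sa].
Qed.
End PositiveStable.

Section Reduction.
Variables (K : numFieldType) (g : lieAlgebra K) (h : {vspace g}).
Hypothesis finR : finite_set (@is_root K g h).
Hypothesis rootN : forall alpha : weight h, is_root alpha -> is_root (- alpha).
Hypothesis weyl_root : forall (sigma : 'End(weight h)) alpha,
  weyl_group sigma -> is_root alpha -> is_root (sigma alpha).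

(** Reduces the computation to two facts about the Weyl group: it permutes the
    roots, and only its identity preserves positivity. *)
Lemma alternation_set_trivial (Delta : seq (weight h)) theta :
  simple_system Delta -> highest_root Delta theta ->
  (forall sigma, weyl_group sigma ->
     (forall alpha, positive_roots Delta alpha ->
        positive_roots Delta (sigma alpha)) -> sigma = \1%VF) ->
  weyl_alternation_set Delta theta theta = [set \1%VF].
Proof.
move=> sD maxt W1; apply/seteqP; split=> [sigma [Ws /(kostant_gt0 finR) Sxi]|_ ->].
  apply: W1 => //.
  apply: (alternating_preserves_positive sD finR rootN (weyl_group_inj Ws)) => //.
    by move=> alpha; apply: weyl_root.
  exact: maxt.
  exact: Sxi.
split; first exact: weyl_one.
by rewrite id_lfunE subrr kostant0.
Qed.
End Reduction.

(** * Weights of diagonal matrices *)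

Lemma double_eq2 (K : numFieldType) (c : K) : c + c = 2 -> c = 1.
Proof.
move=> c2; apply: (@mulIf _ 2); first by rewrite pnatr_eq0.
by rewrite mulr_natr mulr2n mul1r.
Qed.

Lemma eq_opp0 (K : numFieldType) (V : lmodType K) (v : V) : v = - v -> v = 0.
Proof.
move=> /eqP; rewrite -addr_eq0 -mulr2n -scaler_nat scaler_eq0 pnatr_eq0.
by move/eqP.
Qed.

Section DiagonalWeights.
Variables (K : numFieldType) (g : lieAlgebra K) (h : {vspace g}) (n : nat).
Variable f : 'Hom(g, 'M[K]_n).

Definition diag_weight (i : 'I_n) : weight h :=
  linfun (fun x : subvs_of h => f (vsval x) i i : K^o).

Lemma diag_weightE i (x : subvs_of h) : diag_weight i x = f (vsval x) i i.
Proof.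
pose F (u : subvs_of h) : K^o := f (vsval u) i i.
have linF : linear F by move=> c u v; rewrite /F !linearP !mxE.
pose L : {linear subvs_of h -> K^o} :=
  HB.pack F (GRing.isLinear.Build _ _ _ _ F linF).
exact: (lfunE L).
Qed.

Hypothesis f_inj : injective f.
Hypothesis f_bracket : forall x y, f [[x, y]] = f x *m f y - f y *m f x.
Hypothesis f_diag : forall x, (x \in h) = is_diag_mx (f x).

Local Notation eps := diag_weight.

Lemma f_vsval (H : subvs_of h) : f (vsval H) = diag_mx (\row_i eps i H).
Proof.
have := subvsP H; rewrite f_diag => /is_diag_mxP fH.
apply/matrixP => i j; rewrite !mxE; have [<-|ij] := eqVneq i j.
  by rewrite mulr1n diag_weightE.
by rewrite mulr0n fH.
Qed.

Lemma commutator_entry (H : subvs_of h) (M : 'M[K]_n) i j :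
  (f (vsval H) *m M - M *m f (vsval H)) i j = (eps i H - eps j H) * M i j.
Proof.
rewrite f_vsval mul_diag_mx mul_mx_diag !mxE mulrBl; congr (_ - _).
exact: mulrC.
Qed.

(** Bracketing with a diagonal matrix scales each entry separately, so a root
    vector is a matrix all of whose nonzero entries have the same weight. *)
Lemma root_spaceP alpha x : root_space (h := h) alpha x <->
  forall i j, f x i j != 0 -> alpha = eps i - eps j.
Proof.
split=> [Rx i j xij|Rx H].
  apply/lfunP => H; have /(congr1 (fun z => f z i j)) := Rx H.
  rewrite f_bracket commutator_entry linearZ mxE => /(mulIf xij).
  by rewrite add_lfunE opp_lfunE.
apply: f_inj; apply/matrixP => i j.
rewrite f_bracket commutator_entry linearZ mxE.
have [->|/Rx->] := eqVneq (f x i j) 0; first by rewrite !mulr0.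
by rewrite add_lfunE opp_lfunE.
Qed.

Lemma root_of_entry alpha : is_root (h := h) alpha -> alpha != 0 /\
  exists x i j, f x i j != 0 /\ alpha = eps i - eps j.
Proof.
move=> [a0 [x x0 Rx] ]; split=> //.
have /matrix0Pn[i [j xij] ] : f x != 0 by rewrite -(raddf0 f) (inj_eq f_inj).
by exists x, i, j; split=> //; apply: (root_spaceP _ _).1 xij.
Qed.

Lemma finite_is_root : finite_set (@is_root K g h).
Proof.
apply: (@sub_finite_set _ _ [set eps p.1 - eps p.2 | p in [set: 'I_n * 'I_n] ]).
  by move=> a /root_of_entry[_ [_ [i [j [_ ->] ] ] ] ]; exists (i, j).
exact: finite_image.
Qed.

(* [u k] represents [eps k] for the trace form on diagonal matrices; it is the
   orthogonal projection of the k-th diagonal matrix unit to [h]. *)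
Variable u : 'I_n -> subvs_of h.
Hypothesis u_span : forall x : subvs_of h, x = \sum_k (eps k x) *: u k.
Hypothesis u_sym : forall k l, eps k (u l) = eps l (u k).

(** With H = [x, y], invariance of the trace form gives
    tr (H D) = tr (x y) alpha(D) for every D in h.  So H is proportional to the
    element representing alpha, and the normalization alpha(H) = 2 then fixes it
    without any computation of root vectors. *)
Lemma coroot_trace_dual alpha H : is_coroot alpha H ->
  exists c : K, forall k, eps k H = c * alpha (u k).
Proof.
move=> [ [x [y [Rx Ry xyH] ] ] _]; exists (\tr (f x *m f y)) => k.
have : \tr (f (vsval H) *m f (vsval (u k))) = \sum_l eps l H * eps l (u k).
  by rewrite !f_vsval mulmx_diag mxtrace_diag; apply: eq_bigr => l _; rewrite !mxE.
under eq_bigr do rewrite u_sym.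
have -> : \sum_l eps l H * eps k (u l) = eps k H.
  rewrite [X in _ = eps k X]u_span linear_sum; apply: eq_bigr => l _.
  by rewrite linearZ.
move=> <-; rewrite -xyH f_bracket mulmxBl linearB /=.
have := congr1 f (Ry (u k)); rewrite f_bracket linearZ opp_lfunE /= => /eqP.
rewrite scaleNr subr_eq addrC => /eqP yD.
rewrite -[f y *m _ *m _]mulmxA [\tr (f y *m _)]mxtrace_mulC -[f x *m f y *m _]mulmxA.
rewrite -[f x *m f _ *m f y]mulmxA yD.
by rewrite mulmxBr linearB opprB subrKC /= -scalemxAr linearZ mulrC.
Qed.

Lemma diag_weight_ext (sigma : 'End(weight h)) :
  (forall k, sigma (eps k) = eps k) -> sigma = \1%VF.
Proof.
move=> fixe; apply/lfunP => lambda; rewrite id_lfunE.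
have -> : lambda = \sum_k lambda (u k) *: eps k.
  apply/lfunP => x; rewrite sum_lfunE [in LHS](u_span x) linear_sum.
  by apply: eq_bigr => k _; rewrite linearZ scale_lfunE; apply: mulrC.
by rewrite linear_sum; apply: eq_bigr => k _; rewrite linearZ /= fixe.
Qed.
End DiagonalWeights.

Section TraceDuals.
Variables (K : numFieldType) (g : lieAlgebra K) (h : {vspace g}) (n : nat).
Variable f : 'Hom(g, 'M[K]_n).
Hypothesis f_inj : injective f.
Hypothesis f_diag : forall x, (x \in h) = is_diag_mx (f x).
Local Notation eps := (diag_weight h f).

(** P is the matrix of the orthogonal projection of the diagonal matrices onto
    those in the image of h; its rows are the diagonals of the representing
    elements. *)
Lemma trace_duals_exist (P : 'I_n -> 'I_n -> K) :
  (forall k l, P k l = P l k) ->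
  (forall k, exists x, f x = diag_mx (\row_l P k l)) ->
  (forall H l, \sum_k eps k H * P k l = eps l H) ->
  exists u : 'I_n -> subvs_of h,
    [/\ forall x : subvs_of h, x = \sum_k (eps k x) *: u k,
        forall k l, eps k (u l) = eps l (u k)
      & forall k l, eps l (u k) = P k l].
Proof.
move=> Psym /choice[x fx] Pproj.
have xh k : x k \in h by rewrite f_diag fx diag_mx_is_diag.
exists (fun k => vsproj h (x k)).
have uE k l : eps l (vsproj h (x k)) = P k l.
  by rewrite diag_weightE vsprojK // fx !mxE eqxx mulr1n.
split=> // [y|k l]; last by rewrite /= !uE.
apply: val_inj; apply: f_inj; rewrite /= !f_vsval //; congr diag_mx.
apply/rowP => l; rewrite !mxE linear_sum -[LHS]Pproj; apply: eq_bigr => k _.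
by rewrite linearZ /= uE.
Qed.
End TraceDuals.

(** * Trace zero matrices *)

Section SpecialLinear.
Variables (K : numFieldType) (g : lieAlgebra K) (h : {vspace g}) (n : nat).
Variable f : 'Hom(g, 'M[K]_n.+1).
Hypothesis f_inj : injective f.
Hypothesis f_bracket : forall x y, f [[x, y]] = f x *m f y - f y *m f x.
Hypothesis f_diag : forall x, (x \in h) = is_diag_mx (f x).
Hypothesis f_image : forall M, \tr M = 0 <-> exists x, f x = M.
Local Notation eps := (diag_weight h f).

Lemma trace_duals_sl : exists u : 'I_n.+1 -> subvs_of h,
    [/\ forall x : subvs_of h, x = \sum_k (eps k x) *: u k,
        forall k l, eps k (u l) = eps l (u k)
      & forall k l, eps l (u k) = (k == l)%:R - n.+1%:R^-1].
Proof.
apply: trace_duals_exist => // [k l|k|H l].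
- by rewrite eq_sym.
- apply/f_image; rewrite mxtrace_diag.
  under eq_bigr do rewrite mxE.
  rewrite big_split /= (bigD1 k) //= eqxx big1 => [|i /negPf]; last first.
    by rewrite eq_sym => ->.
  by rewrite sumr_const card_ord addr0 mulNrn -[_^-1 *+ _]mulr_natr mulVf ?subrr ?pnatr_eq0.
- have trH : \sum_k eps k H = 0.
    have /esym trH : \tr (f (vsval H)) = 0 by apply/f_image; exists (vsval H).
    by rewrite [RHS]trH f_vsval // mxtrace_diag; apply: eq_bigr => k _; rewrite mxE.
  under eq_bigr do rewrite mulrBr.
  rewrite sumrB -mulr_suml trH mul0r subr0 (bigD1 l) //= eqxx mulr1 big1 ?addr0 //.
  by move=> k /negPf->; rewrite mulr0.
Qed.

Lemma eps_inj_sl : injective eps.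
Proof.
have [u [_ _ uE] ] := trace_duals_sl.
move=> i j /lfunP/(_ (u i)); rewrite !uE => /addIr.
by rewrite eqxx; case: eqVneq => // _ /eqP; rewrite pnatr_eq0.
Qed.

Lemma is_root_sl alpha : is_root (h := h) alpha <->
  exists i j, i != j /\ alpha = eps i - eps j.
Proof.
split=> [/(root_of_entry f_inj f_bracket f_diag)[a0 [x [i [j [_ aE] ] ] ] ]|].
  exists i, j; split=> //; apply: contraNneq a0 => ij.
  by rewrite aE ij subrr.
move=> [i [j [ij ->] ] ]; split; first by rewrite subr_eq0 (inj_eq eps_inj_sl).
have /f_image[x fx] : \tr (delta_mx i j : 'M[K]_n.+1) = 0.
  rewrite /mxtrace big1 // => k _; rewrite mxE.
  by case: eqVneq => [->|//]; rewrite (negPf ij).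
exists x; first by rewrite -(inj_eq f_inj) raddf0 fx; apply/matrix0Pn; exists i, j; rewrite mxE !eqxx oner_eq0.
apply/(root_spaceP f_inj f_bracket f_diag) => k l; rewrite fx mxE.
have [->|_] := eqVneq k i; last by rewrite eqxx.
by have [->|_] := eqVneq l j; rewrite ?eqxx.
Qed.

(** Reflection in eps_i - eps_j exchanges eps_i and eps_j. *)
Lemma weyl_perm_sl (sigma : 'End(weight h)) : weyl_group sigma ->
  exists pi : 'S_n.+1, forall k, sigma (eps k) = eps (pi k).
Proof.
have [u [u_span u_sym uE] ] := trace_duals_sl.
elim=> [|alpha H tau /is_root_sl[i [j [ij ->] ] ] HH _ [pi tauE] ].
  by exists 1%g => k; rewrite id_lfunE perm1.
exists (pi * tperm i j)%g => k; rewrite comp_lfunE tauE permM reflectionE.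
have [c cE] := coroot_trace_dual f_bracket f_diag u_span u_sym HH.
have HE l : eps l H = c * ((l == i)%:R - (l == j)%:R).
  by rewrite cE add_lfunE opp_lfunE !uE opprB subrKA.
case: HH => _; rewrite add_lfunE opp_lfunE !HE !eqxx (negPf ij) eq_sym (negPf ij).
rewrite subr0 sub0r mulrN opprK => c2.
have {}c2 : c = 1 by apply: double_eq2; rewrite -[RHS]c2 !mulr1.
rewrite c2 mul1r.
case: tpermP => [->|->|/eqP/negPf-> /eqP/negPf->].
- by rewrite eqxx (negPf ij) subr0 scale1r subKr.
- by rewrite eqxx eq_sym (negPf ij) sub0r scaleN1r opprK addrC subrK.
- by rewrite subrr scale0r subr0.
Qed.

Theorem alternation_set_sl (Delta : seq (weight h)) theta :
  simple_system Delta -> highest_root Delta theta ->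
  weyl_alternation_set Delta theta theta = [set \1%VF].
Proof.
move=> sD maxt; apply: alternation_set_trivial => //.
- exact: finite_is_root f_inj f_bracket f_diag.
- move=> alpha /is_root_sl[i [j [ij ->] ] ]; apply/is_root_sl; exists j, i.
  by rewrite eq_sym opprB.
- move=> sigma alpha /weyl_perm_sl[pi sE] /is_root_sl[i [j [ij ->] ] ]; apply/is_root_sl.
  by exists (pi i), (pi j); rewrite (inj_eq perm_inj) linearB /= !sE.
move=> sigma /weyl_perm_sl[pi sE] sP.
have [u [u_span _ _] ] := trace_duals_sl.
apply: (diag_weight_ext u_span) => k; rewrite sE; congr (eps _).
apply/esym/eqP; apply: contrapT => /negP kpk.
apply: (perm_displacement_not_root sD sP (k := k) sE).
by apply/is_root_sl; exists k, (pi k).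
Qed.
End SpecialLinear.

(** * Matrices preserving an antidiagonal form

    The orthogonal and symplectic cases are treated together: the form has
    entries s_i at the places (i, i'), where i' = rev_ord i, and it is symmetric
    or alternating according to whether s is even or odd under i -> i'. *)

Section FormPreserving.
Variables (K : numFieldType) (g : lieAlgebra K) (h : {vspace g}) (n : nat).
Variable f : 'Hom(g, 'M[K]_n).
Hypothesis f_inj : injective f.
Hypothesis f_bracket : forall x y, f [[x, y]] = f x *m f y - f y *m f x.
Hypothesis f_diag : forall x, (x \in h) = is_diag_mx (f x).
Variables (orth : bool) (s : 'I_n -> K).
Hypothesis s_sqr : forall i, s i * s i = 1.
Hypothesis s_rev : forall i, s (rev_ord i) = (-1) ^+ (~~ orth) * s i.
Hypothesis f_image : forall M : 'M[K]_n,
  (forall k l, s l * M l k = - (s k * M (rev_ord k) (rev_ord l)))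
    <-> exists x, f x = M.
Local Notation eps := (diag_weight h f).

Let s_neq0 i : s i != 0.
Proof. by apply/eqP => s0; have /esym/eqP := s_sqr i; rewrite s0 mul0r oner_eq0. Qed.

Let rev_fixed_uniq (i j : 'I_n) : i = rev_ord i -> j = rev_ord j -> i = j.
Proof.
move=> /(congr1 val) /= ii /(congr1 val) /= jj; apply: val_inj => /=.
by have := ltn_ord i; have := ltn_ord j; lia.
Qed.

Lemma eps_rev k : eps (rev_ord k) = - eps k.
Proof.
apply/lfunP => H; rewrite opp_lfunE !diag_weightE.
have /f_image/(_ k k) : exists x, f x = f (vsval H) by exists (vsval H).
rewrite -mulrN => /(mulfI (s_neq0 k)) ->.
by rewrite opprK.
Qed.

Lemma trace_duals_form : exists u : 'I_n -> subvs_of h,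
    [/\ forall x : subvs_of h, x = \sum_k (eps k x) *: u k,
        forall k l, eps k (u l) = eps l (u k)
      & forall k l, eps l (u k) = ((k == l)%:R - (rev_ord k == l)%:R) / 2].
Proof.
apply: trace_duals_exist => // [k l|k|H l].
- by rewrite [l == k]eq_sym (can2_eq rev_ordK rev_ordK) [k == rev_ord l]eq_sym.
- apply/f_image => i j; rewrite !mxE (inj_eq rev_ord_inj i j) [i == j]eq_sym.
  have [->|_] := eqVneq j i; last by rewrite !mulr0n !mulr0 oppr0.
  rewrite !mulr1n -mulrN; congr (_ * _).
  rewrite (inj_eq rev_ord_inj) (can2_eq rev_ordK rev_ordK).
  by rewrite -mulNr opprB.
- rewrite (eq_bigr (fun k => 2^-1 * (eps k H * (k == l)%:R - eps k H * (k == rev_ord l)%:R))).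
    rewrite -mulr_sumr sumrB (bigD1 l) //= eqxx mulr1 big1 ?addr0; last first.
      by move=> k /negPf->; rewrite mulr0.
    rewrite (bigD1 (rev_ord l)) //= eqxx mulr1 big1 ?addr0; last first.
      by move=> k /negPf->; rewrite mulr0.
    by rewrite eps_rev opp_lfunE opprK -mulr2n -[eps l H *+ 2]mulr_natl mulKf // pnatr_eq0.
  by move=> k _; rewrite (can2_eq rev_ordK rev_ordK) mulrA mulrBr mulrC.
Qed.

Lemma eps_inj_form : injective eps.
Proof.
have [u [_ _ uE] ] := trace_duals_form.
suff key i j : eps i = eps j -> i != rev_ord i -> i = j.
  move=> i j ij; have [ii|ii] := eqVneq i (rev_ord i); last exact: key ij ii.
  have [jj|jj] := eqVneq j (rev_ord j); last by rewrite (key _ _ (esym ij) jj).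
  exact: rev_fixed_uniq.
move=> /lfunP/(_ (u i)); rewrite !uE eqxx [rev_ord i == i]eq_sym.
have h2 : (2^-1 : K) != 0 by rewrite invr_eq0 pnatr_eq0.
move=> /(mulIf h2) + /negPf ii; rewrite ii subr0; case: eqVneq => // _ /eqP.
by rewrite sub0r -addr_eq0 -natrD pnatr_eq0.
Qed.

(** The entries (i, i') on the antidiagonal vanish for a matrix preserving a
    symmetric form, hence 2 eps_i is a root only in the symplectic case. *)
Definition form_root (i j : 'I_n) := (i != j) && (orth ==> (j != rev_ord i)).

Lemma is_root_form alpha : is_root (h := h) alpha <->
  exists i j, form_root i j /\ alpha = eps i - eps j.
Proof.
split=> [/(root_of_entry f_inj f_bracket f_diag)[a0 [x [i [j [xij aE] ] ] ] ]|].
  exists i, j; split=> //; apply/andP; split.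
    by apply: contraNneq a0 => ij; rewrite aE ij subrr.
  apply/implyP => o; apply: contraNneq xij => jE.
  have /f_image/(_ j i) : exists y, f y = f x by exists x.
  rewrite jE rev_ordK s_rev o mul1r -mulrN => /(mulfI (s_neq0 i))/eqP.
  by rewrite -addr_eq0 -mulr2n mulrn_eq0.
move=> [i [j [/andP[ij oij] ->] ] ].
split; first by rewrite subr_eq0 (inj_eq eps_inj_form).
(* The condition on matrices links the entries (i, j) and (j', i'); for j = i',
   which occurs only in the symplectic case, the two terms add up. *)
pose M : 'M[K]_n := \matrix_(a, b) (s i * ((a == i) && (b == j))%:R
   - s j * ((a == rev_ord j) && (b == rev_ord i))%:R).
have /f_image[x fx] : forall k l, s l * M l k = - (s k * M (rev_ord k) (rev_ord l)).
  move=> k l; rewrite !mxE !(inj_eq rev_ord_inj) ![rev_ord _ == _](can2_eq rev_ordK rev_ordK).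
  rewrite -[RHS]mulrN opprB !mulrBr; congr (_ - _).
    rewrite [(k == j) && _]andbC; case: andP => [ [/eqP-> /eqP->]|_]; last by rewrite !mulr0.
    by rewrite !mulr1 !s_sqr.
  rewrite [(k == rev_ord i) && _]andbC; case: andP => [ [/eqP-> /eqP->]|_]; last by rewrite !mulr0.
  by rewrite !mulr1 !s_rev -!mulrA !s_sqr.
exists x.
  rewrite -(inj_eq f_inj) raddf0 fx; apply/matrix0Pn; exists i, j; rewrite mxE !eqxx /= mulr1.
  case: andP => [ [/eqP iE _]|_]; last by rewrite mulr0 subr0.
  move: oij; rewrite iE rev_ordK eqxx; case o: orth => // _.
  by rewrite mulr1 s_rev o /= expr1 mulN1r -opprD oppr_eq0 -mulr2n mulrn_eq0 negb_or s_neq0.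
apply/(root_spaceP f_inj f_bracket f_diag) => k l; rewrite fx mxE.
case: andP => [ [/eqP-> /eqP->] //|_].
case: andP => [ [/eqP-> /eqP->] _|_]; first by rewrite !eps_rev opprK addrC.
by rewrite !mulr0 subrr eqxx.
Qed.

Lemma form_root_rev i j : form_root i j -> form_root (rev_ord j) (rev_ord i).
Proof.
rewrite /form_root (inj_eq rev_ord_inj) [j == i]eq_sym => /andP[-> /implyP oij].
apply/implyP => /oij; rewrite (inj_eq rev_ord_inj).
by apply: contraNneq => ->; rewrite rev_ordK.
Qed.

(** A reflection is the product of the transpositions of i, j and of i', j',
    which is even, except for the roots 2 eps_i (symplectic case, j = i') and
    eps_i (n odd, j or i the middle index): these give the transposition of i
    and i'. *)
Lemma reflection_form i j H : form_root i j -> is_coroot (eps i - eps j) H ->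
  exists pi : 'S_n, (orth -> ~~ odd n -> ~~ odd_perm pi) /\
    forall k, reflection (eps i - eps j) H (eps k) = eps (pi k).
Proof.
move=> okij HH; set alpha := eps i - eps j in HH *.
(* The root is also eps_j' - eps_i', so i may be assumed not to be the middle
   index. *)
wlog ii : i j okij @alpha HH / i != rev_ord i.
  move=> WL; have [ii|] := eqVneq i (rev_ord i); last exact: WL.
  have aE : alpha = eps (rev_ord j) - eps (rev_ord i).
    by rewrite !eps_rev opprK addrC.
  rewrite aE in HH *; apply: WL => //; first exact: form_root_rev.
  rewrite (inj_eq rev_ord_inj); case/andP: okij => + _.
  by apply: contraNneq => jj; apply/eqP; apply: rev_fixed_uniq.
have [u [u_span u_sym uE] ] := trace_duals_form.
have [c cE] := coroot_trace_dual f_bracket f_diag u_span u_sym HH.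
have HE k : eps k H = c / 2 * ((k == i)%:R - (k == rev_ord i)%:R
    - ((k == j)%:R - (k == rev_ord j)%:R)).
  rewrite cE add_lfunE opp_lfunE !uE ![rev_ord _ == _](can2_eq rev_ordK rev_ordK).
  by rewrite -mulrBl mulrA mulrAC.
have Hrev k : eps (rev_ord k) H = - eps k H by rewrite eps_rev opp_lfunE.
have H0 k : k != i -> k != rev_ord i -> k != j -> k != rev_ord j -> eps k H = 0.
  move=> /negPf ki /negPf ki' /negPf kj /negPf kj'.
  by rewrite HE ki ki' kj kj' !subrr mulr0.
case: HH => _; rewrite add_lfunE opp_lfunE => aH.
have /andP[ij oij] := okij.
have [jE|ji] := eqVneq j (rev_ord i).
  have Hi : eps i H = 1 by apply: double_eq2; rewrite -[RHS]aH jE Hrev opprK.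
  exists (tperm i (rev_ord i)); split=> [o|k].
    by move: oij; rewrite o jE eqxx.
  rewrite reflectionE /alpha jE; case: tpermP => [->|->|/eqP ki /eqP ki'].
  - by rewrite Hi scale1r subKr.
  - by rewrite Hrev Hi scaleN1r opprK addrC subrK.
  - by rewrite H0 ?jE ?rev_ordK // scale0r subr0.
have [jj|jj] := eqVneq j (rev_ord j).
  have ej0 : eps j = 0.
    by apply: eq_opp0; rewrite -eps_rev -jj.
  have Hi : eps i H = 2 by rewrite -[RHS]aH ej0 zero_lfunE subr0.
  exists (tperm i (rev_ord i)); split=> [_|k].
    move: (congr1 val jj) (ltn_ord j) => /=; lia.
  rewrite reflectionE /alpha ej0 subr0; case: tpermP => [->|->|/eqP ki /eqP ki'].
  - by rewrite Hi eps_rev scaler_nat mulr2n opprD addrA subrr sub0r.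
  - by rewrite Hrev Hi eps_rev scaleNr opprK scaler_nat mulr2n addrA addNr add0r.
  - have [->|kj] := eqVneq k j; first by rewrite ej0 zero_lfunE scale0r subr0.
    by rewrite H0 -?jj // scale0r subr0.
have ij' : i != rev_ord j by rewrite -(can2_eq rev_ordK rev_ordK) eq_sym.
have ri : rev_ord i != rev_ord j by rewrite (inj_eq rev_ord_inj).
have Hij : eps j H = - eps i H.
  rewrite !HE !eqxx [j == i]eq_sym (negPf ij) (negPf ii) (negPf ij').
  rewrite (negPf ji) (negPf jj).
  by rewrite !subr0 sub0r mulrN.
have Hi : eps i H = 1 by apply: double_eq2; rewrite -[RHS]aH Hij opprK.
exists (tperm i j * tperm (rev_ord i) (rev_ord j))%g; split=> [_ _|k].
  by rewrite odd_permM !odd_tperm ij ri.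
rewrite reflectionE permM.
have [->|ki] := eqVneq k i.
  by rewrite tpermL tpermD 1?eq_sym // Hi scale1r subKr.
have [->|kj] := eqVneq k j.
  rewrite tpermR tpermD 1?eq_sym //.
  by rewrite Hij Hi scaleN1r opprK addrC subrK.
have [->|ki'] := eqVneq k (rev_ord i).
  rewrite (tpermD ii ji) tpermL !eps_rev.
  by rewrite opp_lfunE Hi scaleN1r opprK addrA addNr sub0r.
have [->|kj'] := eqVneq k (rev_ord j).
  rewrite (tpermD ij' jj) tpermR !eps_rev opp_lfunE Hij Hi opprK scale1r.
  by rewrite opprB addrA addNr sub0r.
by rewrite [tperm i j k]tpermD 1?eq_sym // tpermD 1?eq_sym // H0 // scale0r subr0.
Qed.

Lemma weyl_perm_form (sigma : 'End(weight h)) : weyl_group sigma ->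
  exists pi : 'S_n, (orth -> ~~ odd n -> ~~ odd_perm pi) /\
    forall k, sigma (eps k) = eps (pi k).
Proof.
elim=> [|alpha H tau /is_root_form[i [j [okij ->] ] ] HH _ [pi [odd_pi tauE] ] ].
  by exists 1%g; rewrite odd_perm1; split=> // k; rewrite id_lfunE perm1.
have [pi' [odd_pi' rE] ] := reflection_form okij HH.
exists (pi * pi')%g; split=> [o n_even|k].
  by rewrite odd_permM (negPf (odd_pi o n_even)) (negPf (odd_pi' o n_even)).
by rewrite comp_lfunE tauE permM rE.
Qed.

Lemma is_root_opp_form alpha : is_root (h := h) alpha -> is_root (- alpha).
Proof.
move=> /is_root_form[i [j [okij ->] ] ]; apply/is_root_form; exists j, i.
rewrite opprB; split=> //; move: okij; rewrite /form_root eq_sym.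
by rewrite [i == rev_ord j]eq_sym (can2_eq rev_ordK rev_ordK).
Qed.

Lemma perm_commutes_rev (sigma : 'End(weight h)) (pi : 'S_n) :
  (forall k, sigma (eps k) = eps (pi k)) ->
  forall k, pi (rev_ord k) = rev_ord (pi k).
Proof.
by move=> sE k; apply: eps_inj_form; rewrite -sE !eps_rev linearN /= sE.
Qed.

Theorem alternation_set_form (Delta : seq (weight h)) theta :
  simple_system Delta -> highest_root Delta theta ->
  weyl_alternation_set Delta theta theta = [set \1%VF].
Proof.
move=> sD maxt; apply: alternation_set_trivial => //.
- exact: finite_is_root f_inj f_bracket f_diag.
- exact: is_root_opp_form.
- move=> sigma alpha /weyl_perm_form[pi [_ sE] ] /is_root_form[i [j [okij ->] ] ].
  apply/is_root_form; exists (pi i), (pi j); rewrite linearB /= !sE; split=> //.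
  by rewrite /form_root -(perm_commutes_rev sE) !(inj_eq perm_inj).
move=> sigma /weyl_perm_form[pi [odd_pi sE] ] sP.
have [u [u_span _ _] ] := trace_duals_form.
have pi_rev := perm_commutes_rev sE.
have moved_to_rev k : pi k != k -> orth /\ pi k = rev_ord k.
  move=> kpk; case okk: (form_root k (pi k)).
    case: (perm_displacement_not_root sD sP (k := k) sE).
    by apply/is_root_form; exists k, (pi k).
  move: okk; rewrite /form_root eq_sym kpk /= => /negbT.
  by rewrite negb_imply negbK => /andP[-> /eqP].
have not_both i j : form_root i j -> pi i = rev_ord i -> pi j = rev_ord j -> False.
  move=> okij pii pij.
  apply: (root_not_negated sD sP is_root_opp_form (alpha := eps i - eps j)).
    by apply/is_root_form; exists i, j.
  by rewrite linearB /= !sE pii pij !eps_rev opprD.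
apply: (diag_weight_ext u_span) => i; rewrite sE; congr (eps _).
apply/eqP; apply: contrapT => /negP ipi.
have [o pii] := moved_to_rev i ipi.
have other j : j != i -> j != rev_ord i -> pi j = j.
  move=> ji jri; apply/eqP; apply: contrapT => /negP/moved_to_rev[_ pij].
  by apply: (not_both i j) => //; rewrite /form_root eq_sym ji jri implybT.
have pi_tperm : pi = tperm i (rev_ord i).
  apply/permP => k; case: tpermP => [->|->|/eqP ki /eqP kri] //; last exact: other.
  by rewrite pi_rev pii rev_ordK.
have iri : i != rev_ord i by rewrite -pii eq_sym.
case n_odd: (odd n); last first.
  by have := odd_pi o (negbT n_odd); rewrite pi_tperm odd_tperm iri.
(* For n odd the middle index m has weight 0, and eps_i - eps_m would be
   negated. *)
have mid : (n./2 < n)%N by lia.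
pose m := Ordinal mid.
have mm : m = rev_ord m by apply: val_inj => /=; lia.
have mi : m != i by apply: contraNneq iri => <-; rewrite -mm.
have mri : m != rev_ord i by apply: contraNneq mi => mE; rewrite mm mE rev_ordK.
apply: (not_both i m) => //; last by rewrite -mm other.
by rewrite /form_root eq_sym mi mri implybT.
Qed.
End FormPreserving.

(** * The classical Lie algebras *)

Lemma preserves_formP (K : numFieldType) n (s : 'I_n -> K) (J M : 'M[K]_n) :
  (forall i j, J i j = s i * (j == rev_ord i)%:R) ->
  preserves_form J M <->
  forall k l, s l * M l k = - (s k * M (rev_ord k) (rev_ord l)).
Proof.
move=> JE.
have entry k l : (M^T *m J + J *m M) k (rev_ord l)
    = s l * M l k + s k * M (rev_ord k) (rev_ord l).
  rewrite !mxE (bigD1 l) //= !mxE JE eqxx mulr1 big1 ?addr0 => [|i il]; last first.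
    by rewrite JE (inj_eq rev_ord_inj) eq_sym (negPf il) !mulr0.
  rewrite (bigD1 (rev_ord k)) //= JE eqxx mulr1 big1 ?addr0 => [|i /negPf ik].
    by rewrite mulrC.
  by rewrite JE ik mulr0 mul0r.
split=> [JM k l|sM].
  by apply/eqP; rewrite -addr_eq0 -entry JM mxE.
by apply/matrixP => k l; rewrite -[l]rev_ordK entry sM addNr mxE.
Qed.

Lemma antidiagonal n (i j : 'I_n) : (i + j == n.-1)%N = (j == rev_ord i).
Proof. by rewrite -(inj_eq val_inj) /=; have := ltn_ord i; lia. Qed.

Lemma orthogonal_formP (K : numFieldType) n (M : 'M[K]_n) :
  preserves_form (orthogonal_form K n) M <->
  forall k l, 1 * M l k = - (1 * M (rev_ord k) (rev_ord l)).
Proof.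
apply: (preserves_formP (s := fun=> 1)) => i j.
by rewrite mxE antidiagonal mul1r.
Qed.

Theorem corollary8p2 (R : realType) (X : classical_type) (r : nat)
    (g : lieAlgebra R[i]) (h : {vspace g})
    (Delta : seq (weight h)) (theta : weight h) :
  simple_rank X r ->
  classical_with_cartan X r h ->
  simple_system Delta ->
  highest_root Delta theta ->
  weyl_alternation_set Delta theta theta = [set \1%VF].
Proof.
move=> _ [f [f_inj f_image f_bracket f_diag] ].
case: X f f_inj f_image f_bracket f_diag => f f_inj f_image f_bracket f_diag.
- exact: alternation_set_sl f_inj f_bracket f_diag f_image _ _.
- apply: (alternation_set_form f_inj f_bracket f_diag (orth := true) (s := fun=> 1)).
  + by move=> i; rewrite mulr1.
  + by move=> i; rewrite mulr1.
  + by move=> M; rewrite -orthogonal_formP; apply: f_image.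
- pose s (i : 'I_(r.*2)) : R[i] := (-1) ^+ (r.*2./2 <= i)%N.
  apply: (alternation_set_form f_inj f_bracket f_diag (orth := false) (s := s)).
  + by move=> i; rewrite -expr2 sqrr_sign.
  + move=> i; rewrite /s -signr_addb; congr (_ ^+ nat_of_bool _).
    rewrite /= doubleK -ltnNge; have : (i < r.*2)%N := ltn_ord i.
    by move=> ?; apply/idP/idP; lia.
  + move=> M; rewrite -f_image /= -(preserves_formP (J := symplectic_form _ _)) //.
    by move=> i j; rewrite mxE antidiagonal.
- apply: (alternation_set_form f_inj f_bracket f_diag (orth := true) (s := fun=> 1)).
  + by move=> i; rewrite mulr1.
  + by move=> i; rewrite mulr1.
  + by move=> M; rewrite -orthogonal_formP; apply: f_image.
Qed.
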